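(* Let $X\subset\mathbb{R}^d$ be relatively separated and let $\mathcal{H}$ be a Hilbert space. For any $s>d$, $(\mathcal{J}_s,|\|\cdot\||_{\mathcal{J}_s})$, $\mathcal{J}_s=\mathcal{J}_s(X;\mathcal{B}(\mathcal{H}))$, is a unital Banach $*$-algebra with respect to matrix multiplication and the involution $[A^*]_{k,l}=(A_{l,k})^*$.
   Context: A set $X\subset\mathbb{R}^d$ is relatively separated if $\sup_{x\in\mathbb{R}^d}|X\cap(x+[0,1]^d)|<\infty$ (where $|\cdot|$ of a set is its cardinality). $\mathcal{B}(\mathcal{H})$ denotes the bounded linear operators on $\mathcal{H}$. For $s\ge 0$ let $\nu_s(x)=(1+|x|)^s$, $x\in\mathbb{R}^d$, with $|x|$ the Euclidean norm. $\mathcal{J}_s=\mathcal{J}_s(X;\mathcal{B}(\mathcal{H}))$ is the space of all $\mathcal{B}(\mathcal{H})$-valued matrices $A=[A_{k,l}]_{k,l\in X}$ with $\|A\|_{\mathcal{J}_s}:=\sup_{k,l\in X}\|A_{k,l}\|\,\nu_s(k-l)<\infty$. Matrix multiplication is $[A\cdot B]_{k,l}=\sum_{n\in X}A_{k,n}B_{n,l}$, and the unit is the diagonal matrix with the identity of $\mathcal{B}(\mathcal{H})$ on the diagonal. For $A\in\mathcal{J}_s$, $|\|A\||_{\mathcal{J}_s}:=\sup\{\|A\cdot B\|_{\mathcal{J}_s}: B\in\mathcal{J}_s,\ \|B\|_{\mathcal{J}_s}=1\}$. Here a Banach $*$-algebra means an associative algebra that is complete under a submultiplicative norm and carries a continuous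 (conjugate-linear, anti-multiplicative, involutive) involution; the involution is not required to be isometric for the norm. *)

(* Defs.v *)
From HB Require Import structures.
From mathcomp Require Import all_boot all_order all_algebra.
From mathcomp Require Import sesquilinear complex.
From mathcomp Require Import all_classical all_reals all_analysis.
From mathcomp Require Import summability.

Set Implicit Arguments.
Unset Strict Implicit.
Unset Printing Implicit Defensive.

Import Order.TTheory GRing.Theory Num.Theory.
Import numFieldNormedType.Exports.

Local Open Scope classical_set_scope.
Local Open Scope ring_scope.
Local Open Scope card_scope.
Local Open Scope complex_scope.

(* Norms on modules over R[i] take their values in R[i]; rnorm is the same norm
   seen in R. *)
Definition rnorm (R : realType) (V : normedZmodType R[i]) (x : V) : R :=
  complex.Re `|x|.

Lemma rnormE (R : realType) (V : normedZmodType R[i]) (x : V) :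
  (rnorm x)%:C = `|x|.
Proof. by rewrite /rnorm RRe_real// normr_real. Qed.

Lemma rnorm_ge0 (R : realType) (V : normedZmodType R[i]) (x : V) :
  0 <= rnorm x.
Proof. by have := normr_ge0 x; rewrite -rnormE ler0c. Qed.

Lemma rnorm_gt0 (R : realType) (V : normedZmodType R[i]) (x : V) :
  (0 < rnorm x) = (x != 0).
Proof. by rewrite -normr_gt0 -rnormE -[0 in RHS]/(0%:C) ltcR. Qed.

(* Complex Hilbert spaces; the inner product is linear in its first argument
   and conjugate-linear in the second. *)
HB.mixin Record isHilbert (R : realType) H & CompleteNormedModule R[i] H := {
  inner : {dot H for (@Num.conj R[i])};
  inner_norm : forall x : H, inner x x = `|x| ^+ 2
}.

#[short(type="hilbertType")]
HB.structure Definition Hilbert (R : realType) :=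
  {H of isHilbert R H & CompleteNormedModule R[i] H}.

Section BoundedOperators.
Variables (R : realType) (H : normedModType R[i]).

Definition bounded_op : {pred H -> H} :=
  mem [set f : H -> H |
    linear f /\ exists M : R[i], forall x, `|f x| <= M * `|x|].

Lemma bounded_opP (f : H -> H) : reflect
  (linear f /\ exists M : R[i], forall x, `|f x| <= M * `|x|)
  (f \in bounded_op).
Proof. by apply: (iffP idP) => [/set_mem|/mem_set]. Qed.

Lemma bounded_op_submod_closed : submod_closed bounded_op.
Proof.
split=> [|a f g /bounded_opP[fl [M fM]] /bounded_opP[gl [N gN]]].
  apply/bounded_opP; split=> [a x y|]; first by rewrite /= scaler0 addr0.
  by exists 0 => x; rewrite normr0 mul0r.
apply/bounded_opP; split=> [b x y|].
  rewrite addrfctE scalrfctE /= fl gl !scalerDr !scalerA (mulrC b a).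
  by rewrite addrACA.
exists (`|a| * M + N) => x; rewrite mulrDl (le_trans (ler_normD _ _))//.
by rewrite lerD// normrZ -mulrA ler_wpM2l.
Qed.

HB.instance Definition _ := GRing.isSubmodClosed.Build _ _ bounded_op
  bounded_op_submod_closed.

Record boundedOp := BoundedOp {
  boundedOp_fun :> H -> H ;
  boundedOp_bounded : boundedOp_fun \in bounded_op }.

HB.instance Definition _ := [isSub for boundedOp_fun].
HB.instance Definition _ := [Choice of boundedOp by <:].
HB.instance Definition _ := [SubChoice_isSubLmodule of boundedOp by <:].

Implicit Types f g : boundedOp.

Lemma boundedOp_linear f : linear f.
Proof. by case/bounded_opP: (boundedOp_bounded f). Qed.

HB.instance Definition _ f :=
  GRing.isLinear.Build _ _ _ _ (boundedOp_fun f) (boundedOp_linear f).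

Definition opnorm f : R := sup [set rnorm (f x) | x in [set x | rnorm x <= 1]].

Lemma rnormD (x y : H) : rnorm (x + y) <= rnorm x + rnorm y.
Proof. by have := ler_normD x y; rewrite -!rnormE -rmorphD lecR. Qed.

Lemma rnormZ (a : R[i]) (x : H) : rnorm (a *: x) = rnorm a * rnorm x.
Proof. by apply: complexI; rewrite rmorphM/= !rnormE normrZ. Qed.

Lemma rnorm0 : rnorm (0 : H) = 0.
Proof. by rewrite /rnorm normr0. Qed.

Lemma boundedOp_bound f : exists2 M : R, 0 <= M &
  forall x, rnorm (f x) <= M * rnorm x.
Proof.
have /bounded_opP[_ [M fM]] := boundedOp_bounded f.
exists (rnorm M) => [|x]; first exact: rnorm_ge0.
rewrite -lecR rmorphM/= !rnormE -[leRHS]ger0_norm ?mulr_ge0//.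
rewrite normrM !normr_id -(normr_id x) -normrM.
by rewrite ger0_norm// (le_trans (normr_ge0 (f x))).
Qed.

Lemma opnorm_has_sup f :
  has_sup [set rnorm (f x) | x in [set x | rnorm x <= 1]].
Proof.
split; first by exists (rnorm (f 0)), 0 => //=; rewrite rnorm0.
have [M M0 fM] := boundedOp_bound f.
by exists M => _ [x /= x1 <-]; rewrite (le_trans (fM x))// ler_piMr.
Qed.

Lemma opnorm_ub f x : rnorm x <= 1 -> rnorm (f x) <= opnorm f.
Proof. by move=> x1; apply: (sup_upper_bound (opnorm_has_sup f)); exists x. Qed.

Lemma opnorm_le f (M : R) :
  (forall x, rnorm x <= 1 -> rnorm (f x) <= M) -> opnorm f <= M.
Proof.
move=> fM; apply: ge_sup; first by case: (opnorm_has_sup f).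
by move=> _ [x x1 <-]; exact: fM.
Qed.

Lemma opnorm_ge0 f : 0 <= opnorm f.
Proof. by rewrite (le_trans (rnorm_ge0 (f 0)))// opnorm_ub// rnorm0. Qed.

Lemma opnormD f g : (opnorm (f + g))%:C <= (opnorm f)%:C + (opnorm g)%:C.
Proof.
rewrite -rmorphD lecR; apply: opnorm_le => x x1.
by rewrite (le_trans (rnormD _ _))// lerD// opnorm_ub.
Qed.

Lemma opnormZ (a : R[i]) f : (opnorm (a *: f))%:C = `|a| * (opnorm f)%:C.
Proof.
have leZ b h : opnorm (b *: h) <= rnorm b * opnorm h.
  by apply: opnorm_le => x x1; rewrite rnormZ ler_wpM2l ?rnorm_ge0// opnorm_ub.
rewrite -rnormE -rmorphM; congr (_%:C); apply/eqP; rewrite eq_le leZ /=.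
have [->|a0] := eqVneq a 0.
  by rewrite /rnorm normr0 mul0r opnorm_ge0.
have ra0 : 0 < rnorm a by rewrite rnorm_gt0.
rewrite -ler_pdivlMl//; have := leZ a^-1 (a *: f).
rewrite scalerA mulVf// scale1r => /le_trans -> //.
suff -> : rnorm a^-1 = (rnorm a)^-1 by [].
by apply: complexI; rewrite rnormE fmorphV/= rnormE normfV.
Qed.

Lemma opnorm0_eq0 f : (opnorm f)%:C = 0 -> f = 0.
Proof.
move=> /complexI f0; apply/val_inj/funext => x /=.
have [->|x0] := eqVneq x 0; first by rewrite linear0.
have rx0 : 0 < rnorm x by rewrite rnorm_gt0.
pose c : R[i] := `|x|^-1.
have rc : rnorm c = (rnorm x)^-1.
  by apply: complexI; rewrite rnormE /c normfV normr_id fmorphV/= rnormE.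
have := @opnorm_ub f (c *: x); rewrite linearZ/= !rnormZ rc mulVf ?gt_eqF//.
rewrite f0 => /(_ (lexx _)); rewrite pmulr_rle0 ?invr_gt0// => fx0.
by apply: contraTeq fx0; rewrite -rnorm_gt0 -ltNge.
Qed.

HB.instance Definition _ := Lmodule_isNormed.Build R[i] boundedOp
  opnormD opnormZ opnorm0_eq0.

Lemma bounded_op_id : id \in bounded_op.
Proof. by apply/bounded_opP; split=> //; exists 1 => x; rewrite mul1r. Qed.

Definition op_id : boundedOp := BoundedOp bounded_op_id.

Lemma bounded_op_comp f g : f \o g \in bounded_op.
Proof.
apply/bounded_opP; split=> [a x y|]; first by rewrite /= !linearP.
have [M M0 fM] := boundedOp_bound f; have [N _ gN] := boundedOp_bound g.
exists (M * N)%:C => x; rewrite -!rnormE -rmorphM lecR.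
by rewrite (le_trans (fM _))// -mulrA ler_wpM2l.
Qed.

Definition op_comp f g : boundedOp := BoundedOp (bounded_op_comp f g).

End BoundedOperators.

(* The set is a singleton, by the Riesz representation theorem. *)
Definition adjoint (R : realType) (H : hilbertType R) (f : boundedOp H) :
    boundedOp H :=
  xget 0 [set g : boundedOp H | forall x y : H,
            inner (f x) y = inner x (g y)].

Definition euclidean_norm (R : realType) (d : nat) (x : 'rV[R]_d) : R :=
  Num.sqrt (\sum_(i < d) x ord0 i ^+ 2).

Definition relatively_separated (R : realType) (d : nat) (X : set 'rV[R]_d) :=
  exists N : nat, forall x : 'rV[R]_d,
    (X `&` [set y | forall i, (0 <= y ord0 i - x ord0 i <= 1)%R]) #<= `I_N.

Definition nu (R : realType) (d : nat) (s : R) (x : 'rV[R]_d) : R :=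
  (1 + euclidean_norm x) `^ s.

Section JaffardAlgebra.
Variables (R : realType) (d : nat) (X : set 'rV[R]_d) (H : hilbertType R).

Definition opmatrix := X -> X -> boundedOp H.

HB.instance Definition _ := GRing.Lmodule.on opmatrix.

Implicit Types A B : opmatrix.

Definition weighted_entries (s : R) A : set R :=
  [set rnorm (A kl.1 kl.2) * nu s (val kl.1 - val kl.2) | kl in [set: X * X]].

Definition Jaffard (s : R) : set opmatrix :=
  [set A | has_ubound (weighted_entries s A)].

(* When X is empty the supremum is that of the empty set, which is 0. *)
Definition normJ (s : R) A : R := sup (weighted_entries s A).

Definition opmatrix_mul_term A B (k l n : X) : boundedOp H :=
  op_comp (A k n) (B n l).

(* The sum over X is the limit, in operator norm, of the net of finite partial
   sums. *)
Definition opmatrix_mul A B : opmatrix :=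
  fun k l => sum (opmatrix_mul_term A B k l).

Definition opmatrix_mul_cvg A B :=
  forall k l, cvg (partial_sum (opmatrix_mul_term A B k l) @ totally).

Definition opmatrix_one : opmatrix :=
  fun k l => if k == l then op_id H else 0.

Definition opmatrix_star A : opmatrix := fun k l => adjoint (A l k).

Definition multiplier_norms (s : R) A : set R :=
  [set normJ s (opmatrix_mul A B) | B in Jaffard s `&` [set B | normJ s B = 1]].

(* If X is empty or H is trivial, the supremum is that of the empty set, which
   is 0. *)
Definition tnormJ (s : R) A : R := sup (multiplier_norms s A).

End JaffardAlgebra.

Arguments Jaffard {R d} X H s.
Arguments opmatrix_mul {R d X H} A B.
Arguments opmatrix_one {R d} X H.
Arguments opmatrix_star {R d X H} A.
Arguments tnormJ {R d X H} s A.

(* The algebra is a subset J of an ambient complex vector space V; the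
   operations and the norm are total functions on V of which only the values
   on J are constrained. *)
Record unital_banach_star_algebra (R : realType) (V : lmodType R[i])
    (J : set V) (mul : V -> V -> V) (one : V) (star : V -> V) (N : V -> R) :
    Prop := UnitalBanachStarAlgebra {
  bsa_mem0 : J 0 ;
  bsa_memP : forall (a : R[i]) x y, J x -> J y -> J (a *: x + y) ;
  bsa_memM : forall x y, J x -> J y -> J (mul x y) ;
  bsa_mem1 : J one ;
  bsa_mem_star : forall x, J x -> J (star x) ;

  bsa_mulA : forall x y z, J x -> J y -> J z ->
    mul x (mul y z) = mul (mul x y) z ;
  bsa_mulPl : forall (a : R[i]) x y z, J x -> J y -> J z ->
    mul (a *: x + y) z = a *: mul x z + mul y z ;
  bsa_mulPr : forall (a : R[i]) x y z, J x -> J y -> J z ->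
    mul z (a *: x + y) = a *: mul z x + mul z y ;
  bsa_mul1 : forall x, J x -> mul one x = x ;
  bsa_mulr1 : forall x, J x -> mul x one = x ;

  bsa_norm_ge0 : forall x, J x -> 0 <= N x ;
  bsa_norm0_eq0 : forall x, J x -> N x = 0 -> x = 0 ;
  bsa_normZ : forall (a : R[i]) x, J x -> N (a *: x) = rnorm a * N x ;
  bsa_normD : forall x y, J x -> J y -> N (x + y) <= N x + N y ;
  bsa_normM : forall x y, J x -> J y -> N (mul x y) <= N x * N y ;
  bsa_complete : forall u : nat -> V, (forall n, J (u n)) ->
    (forall e : R, 0 < e -> exists n0 : nat, forall m n : nat,
       (n0 <= m)%N -> (n0 <= n)%N -> N (u m - u n) < e) ->
    exists2 x, J x & N (u n - x) @[n --> \oo] --> (0 : R) ;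

  bsa_starP : forall (a : R[i]) x y, J x -> J y ->
    star (a *: x + y) = Num.conj a *: star x + star y ;
  bsa_starM : forall x y, J x -> J y -> star (mul x y) = mul (star y) (star x) ;
  bsa_starK : forall x, J x -> star (star x) = x ;
  bsa_star_continuous : forall x, J x -> forall e : R, 0 < e ->
    exists2 r : R, 0 < r &
      forall y, J y -> N (y - x) < r -> N (star y - star x) < e
}.

(* Main.v *)
From HB Require Import structures.
Require Import Defs.
From mathcomp Require Import all_boot all_order all_algebra.
From mathcomp Require Import sesquilinear complex.
From mathcomp Require Import all_classical all_reals all_analysis.
From mathcomp Require Import summability finmap.
From mathcomp Require Import ring lra zify.

Set Implicit Arguments.
Unset Strict Implicit.
Unset Printing Implicit Defensive.

Import Order.TTheory GRing.Theory Num.Theory.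
Import numFieldNormedType.Exports.
Local Open Scope classical_set_scope.
Local Open Scope ring_scope.

(** The statement rests on one estimate about the weights [w k l = 1 / nu s (k - l)]:
    the sum over [n] in [X] of [w k n * w n l] is at most [C * w k l], with [C]
    independent of [k] and [l] ([nuV_convolution_bounded]). Indeed [1 + |k - l|] is at
    most twice the larger of [1 + |k - n|] and [1 + |n - l|], so the product of the two
    weights is at most [2 `^ s * w k l * (w k n + w n l)], and the sums of [w k n]
    over [n] are bounded uniformly in [k] because [X] has boundedly many points in
    each unit cube and [s > d] ([sum_nuV_bounded]).

    Granted the estimate, the products of two matrices of the Jaffard class converge
    absolutely in operator norm, and the Jaffard norm satisfies
    [|AB| <= C * |A| * |B|] ([Jaffard_mul]). Associativity is Fubini for absolutely
    summable double families of operators ([sum_exchange]). The norm [tnormJ] is the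
    operator norm of the left multiplication by [A]: it is submultiplicative for
    that reason ([tnormJM]), and it is equivalent to the Jaffard norm
    ([normJ_le_tnormJ], [tnormJ_le_normJ]), the lower bound coming from the unit
    matrix. The equivalence carries over the completeness of the Jaffard norm
    ([normJ_complete]), which follows from that of the space of bounded operators, and
    the continuity of the involution, which is isometric for the Jaffard norm.

    The involution needs the existence of adjoints, hence the Riesz representation
    theorem ([riesz]), which is proved by minimising the norm on the hyperplane where
    the functional equals 1. *)

(** * Real-valued norms and the completeness of the space of bounded operators *)

Section RealNorm.
Variables (R : realType) (V : normedModType R[i]).
Implicit Types x y : V.

Lemma rnormN x : rnorm (- x) = rnorm x.
Proof. by rewrite /rnorm normrN. Qed.

Lemma rnorm_dist x y : rnorm (x - y) = rnorm (y - x).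
Proof. by rewrite -rnormN opprB. Qed.

Lemma rnorm_eq0 x : (rnorm x == 0) = (x == 0).
Proof. by rewrite -[RHS]negbK -rnorm_gt0 lt_def rnorm_ge0 andbT negbK. Qed.

Lemma rnorm_distD z x y : rnorm (x - y) <= rnorm (x - z) + rnorm (z - y).
Proof. by rewrite (le_trans _ (rnormD _ _))// addrA subrK. Qed.

Lemma rnorm_sum (I : Type) (r : seq I) (P : pred I) (F : I -> V) :
  rnorm (\sum_(i <- r | P i) F i) <= \sum_(i <- r | P i) rnorm (F i).
Proof.
elim/big_ind2 : _ => [|a x b y ax byl|//]; first by rewrite rnorm0.
by rewrite (le_trans (rnormD _ _))// lerD.
Qed.

Lemma rnorm_le_eps_eq x y : (forall e : R, 0 < e -> rnorm (x - y) <= e) -> x = y.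
Proof.
move=> xy; apply/eqP; rewrite -subr_eq0 -rnorm_eq0 eq_le rnorm_ge0 andbT.
by apply/ler_addgt0Pl => e e0; rewrite addr0 xy.
Qed.

(** The order of [R[i]] compares numbers with the same imaginary part only, so
    a positive complex radius is a real one; this turns statements about complex
    radii into statements about real ones. *)
Lemma complex_gt0P (e : R[i]) : 0 < e -> exists2 r : R, 0 < r & e = (r%:C)%C.
Proof.
move=> e0; exists (complex.Re e); last by rewrite RRe_real// gtr0_real.
by rewrite -ltcR RRe_real// gtr0_real.
Qed.

Lemma cvg_rnormP (T : Type) (F : set_system T) {FF : Filter F} (f : T -> V) y :
  f @ F --> y <->
  forall e : R, 0 < e -> \forall t \near F, rnorm (y - f t) < e.
Proof.
split=> [/cvgrPdist_lt fy e e0|fy].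
  have /fy : 0 < (e%:C)%C by rewrite ltcR.
  by apply: filterS => t; rewrite -rnormE ltcR.
apply/cvgrPdist_lt => _ /complex_gt0P[e e0 ->].
by apply: filterS (fy _ e0) => t; rewrite -rnormE ltcR.
Qed.

Lemma cauchy_rnormP (F : set_system V) {FF : ProperFilter F} :
  cauchy F <-> forall e : R, 0 < e -> exists x, \forall y \near F, rnorm (x - y) < e.
Proof.
split=> [/cauchyP Fc e e0|Fc].
  have /Fc[x Fx] : 0 < (e%:C)%C by rewrite ltcR.
  exists x; apply: filterS Fx => y; rewrite -ball_normE /ball_/= -rnormE.
  by rewrite ltcR.
apply/cauchyP => _ /complex_gt0P[e e0 ->].
have [x Fx] := Fc e e0; exists x; apply: filterS Fx => y.
by rewrite -ball_normE /ball_/= -rnormE ltcR.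
Qed.

Lemma cvg_rnorm_le (T : Type) (F : set_system T) {FF : ProperFilter F}
    (f : T -> V) x y (M : R) :
  f @ F --> y -> (\forall t \near F, rnorm (x - f t) <= M) -> rnorm (x - y) <= M.
Proof.
move=> /cvg_rnormP fy fM; apply/ler_addgt0Pr => e e0.
have [t [/= tM te]] := filter_ex (filterI fM (fy e e0)).
by rewrite (le_trans (rnorm_distD (f t) _ _))// lerD// rnorm_dist ltW.
Qed.

End RealNorm.

Section BoundedOperatorTheory.
Variables (R : realType) (H : normedModType R[i]).
Implicit Types f g h : boundedOp H.

Lemma boundedOpE f g : f = g <-> forall x, f x = g x.
Proof. by split=> [->//|fg]; apply/val_inj/funext. Qed.

Lemma boundedOp_ub f x : rnorm (f x) <= rnorm f * rnorm x.
Proof.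
have [->|x0] := eqVneq x 0; first by rewrite linear0 !rnorm0 mulr0.
have rx : 0 < rnorm x by rewrite rnorm_gt0.
pose c : R[i] := ((rnorm x)^-1%:C)%C.
have rc : rnorm c = (rnorm x)^-1.
  by apply: complexI; rewrite rnormE ger0_norm// ler0c invr_ge0 ltW.
have := @opnorm_ub _ _ f (c *: x); rewrite linearZ/= !rnormZ rc mulVf ?gt_eqF//.
by move=> /(_ (lexx _)); rewrite ler_pdivrMl// mulrC.
Qed.

Lemma boundedOp_le f (M : R) : 0 <= M ->
  (forall x, rnorm (f x) <= M * rnorm x) -> rnorm f <= M.
Proof.
move=> M0 fM; apply: opnorm_le => x x1.
by rewrite (le_trans (fM x))// ler_piMr.
Qed.

Lemma op_compE f g x : op_comp f g x = f (g x). Proof. by []. Qed.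

Lemma op_comp_le f g : rnorm (op_comp f g) <= rnorm f * rnorm g.
Proof.
apply: boundedOp_le => [|x]; first by rewrite mulr_ge0 ?rnorm_ge0.
rewrite op_compE (le_trans (boundedOp_ub _ _))// -mulrA ler_wpM2l ?rnorm_ge0//.
exact: boundedOp_ub.
Qed.

Lemma op_compA f g h : op_comp f (op_comp g h) = op_comp (op_comp f g) h.
Proof. exact/boundedOpE. Qed.

Lemma op_comp_linearl h : linear (fun f => op_comp f h).
Proof. by move=> a f g; exact/boundedOpE. Qed.

Lemma op_comp_linearr h : linear (op_comp h).
Proof. by move=> a f g; apply/boundedOpE => x; rewrite /= linearP. Qed.

Lemma op_id_le1 : rnorm (op_id H) <= 1.
Proof. by apply: boundedOp_le => // x; rewrite mul1r. Qed.

End BoundedOperatorTheory.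

Section BoundedOperatorComplete.
Variables (R : realType) (H : completeNormedModType R[i]).

(** The limit is taken pointwise. If almost all operators of the filter are
    within [e] of [f0], then so is the pointwise limit, by passing to the limit in
    each vector; this gives both its boundedness and the convergence in operator
    norm. *)
Lemma boundedOp_cauchy_cvg (F : set_system (boundedOp H)) :
  ProperFilter F -> cauchy F -> cvg F.
Proof.
move=> FF /cauchy_rnormP Fc.
have ptw x : cvg ((fun f : boundedOp H => f x) @ F).
  apply: cauchy_cvg; apply/cauchy_rnormP => e e0.
  have [f0 Ff0] := Fc (e / (rnorm x + 1)) (divr_gt0 e0 (ltr_wpDl (rnorm_ge0 x) ltr01)).
  exists (f0 x); apply: filterS Ff0 => f.
  rewrite ltr_pdivlMr ?ltr_wpDl ?rnorm_ge0//; apply: le_lt_trans.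
  rewrite (le_trans (boundedOp_ub (f0 - f) x))//.
  by rewrite ler_wpM2l ?rnorm_ge0// lerDl.
pose g x := lim ((fun f : boundedOp H => f x) @ F).
have gl : linear g.
  move=> a x y; apply: cvg_lim => //.
  rewrite (_ : (fun f => _) = (fun f : boundedOp H => a *: f x + f y)); last first.
    by apply/funext => f; rewrite linearP.
  by apply: cvgD; [apply: cvgZ; [exact: cvg_cst|exact: ptw]|exact: ptw].
(* Distances to a member of the filter survive the pointwise limit. *)
have close (f0 : boundedOp H) (e : R) : (\forall f \near F, rnorm (f0 - f) < e) ->
    forall x, rnorm (f0 x - g x) <= e * rnorm x.
  move=> Ff0 x; apply: (cvg_rnorm_le (ptw x)).
  apply: filterS Ff0 => f /ltW fe.
  by rewrite (le_trans (boundedOp_ub (f0 - f) x))// ler_wpM2r ?rnorm_ge0.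
have gb : g \in @bounded_op _ H.
  apply/bounded_opP; split=> //; have [f0 Ff0] := Fc 1 ltr01.
  exists ((rnorm f0 + 1)%:C)%C => x; rewrite -!rnormE -rmorphM lecR.
  rewrite -[g x](subrK (f0 x)) addrC mulrDl (le_trans (rnormD _ _))// lerD//.
    exact: boundedOp_ub.
  by rewrite rnorm_dist close.
apply/cvg_ex; exists (BoundedOp gb); apply/(@cvg_rnormP _ _ _ F _ id) => e e0.
have [f0 Ff0] := Fc (e / 3) (divr_gt0 e0 (ltr0n _ 3)).
have f0g : rnorm (BoundedOp gb - f0) <= e / 3.
  apply: boundedOp_le => [|x]; first by rewrite divr_ge0// ltW.
  by rewrite /= rnorm_dist close.
apply: filterS Ff0 => f f0f.
apply: le_lt_trans (rnorm_distD f0 _ _) _.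
by apply: le_lt_trans (lerD f0g (ltW f0f)) _; lra.
Qed.

HB.instance Definition _ :=
  Uniform_isComplete.Build (boundedOp H) boundedOp_cauchy_cvg.

End BoundedOperatorComplete.

(** * Unordered absolutely convergent sums *)

#[local] Existing Instance totally_filter.

Lemma partial_sumE (I : choiceType) (V : zmodType) (x : I -> V) (A : {fset I}) :
  partial_sum x A = \sum_(i <- A) x i.
Proof. by rewrite big_seq_fsetE. Qed.

Lemma big_fsetM (I J : choiceType) (V : zmodType) (x : I -> J -> V)
    (A : {fset I}) (B : {fset J}) :
  \sum_(p <- (A `*` B)%fset) x p.1 p.2 = \sum_(i <- A) \sum_(j <- B) x i j.
Proof.
transitivity (\sum_(p <- [seq (i, j) | i <- A, j <- B]) x p.1 p.2); last first.
  by rewrite big_allpairs.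
apply: perm_big; apply: uniq_perm; first exact: fset_uniq.
  by rewrite allpairs_uniq ?fset_uniq// => -[? ?] [? ?].
move=> [i j]; rewrite in_fsetM; apply/andP/allpairsP => [[iA jB]|].
  by exists (i, j).
by case=> -[i' j'] [? ? [-> ->]].
Qed.

Lemma sum_fsetD (I : choiceType) (W : zmodType) (f : I -> W)
    (A0 A : {fset I}) :
  (A0 `<=` A)%fset ->
  \sum_(i <- A) f i = \sum_(i <- A0) f i + \sum_(i <- (A `\` A0)%fset) f i.
Proof.
move=> A0A; rewrite (big_fsetIDcond _ (mem A0))/=; congr +%R.
  congr (\sum_(i <- enum_fset _) _); apply/fsetP => i; rewrite !inE andbC.
  by case: (boolP (i \in A0)) => //= /(fsubsetP A0A).
congr (\sum_(i <- enum_fset _) _); apply/fsetP => i; rewrite !inE.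
by rewrite andbC.
Qed.

Section AbsolutelyConvergent.
Variables (R : realType) (I : choiceType) (V : completeNormedModType R[i]).
Implicit Types (x : I -> V) (A : {fset I}) (M : R).

(** Absolute summability in a form that needs only finite sums; the bound is
    kept because it also bounds the norm of the sum. *)
Definition abs_bounded x M := forall A, \sum_(i <- A) rnorm (x i) <= M.

(** A finite set whose sum of norms is within [e] of the supremum of all such
    sums leaves less than [e] to any finite set disjoint from it. *)
Lemma abs_bounded_tail x M (e : R) : abs_bounded x M -> 0 < e ->
  exists A0 : {fset I}, forall A, (A0 `<=` A)%fset ->
    rnorm (partial_sum x A0 - partial_sum x A) < e.
Proof.
move=> xM e0; pose S := [set \sum_(i <- A) rnorm (x i) | A in [set: {fset I}]].
have supS : has_sup S.
  by split; [exists (\sum_(i <- fset0) rnorm (x i)), fset0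
            |exists M => _ [A _ <-]; exact: xM].
have [_ [A0 _ <-] ltA0] := sup_adherent e0 supS.
exists A0 => A A0A; rewrite rnorm_dist !partial_sumE (sum_fsetD _ A0A).
rewrite addrAC subrr add0r (le_lt_trans (rnorm_sum _ _ _))//.
have : \sum_(i <- A) rnorm (x i) <= sup S.
  by apply: (sup_upper_bound supS); exists A.
rewrite (sum_fsetD _ A0A); move: ltA0; lra.
Qed.

Lemma abs_bounded_cvg x M : abs_bounded x M -> cvg (partial_sum x @ totally).
Proof.
move=> xM; apply: cauchy_cvg; apply/cauchy_rnormP => e e0.
have [A0 A0e] := abs_bounded_tail xM e0.
by exists (partial_sum x A0); exists A0.
Qed.

Lemma abs_bounded_le x M : abs_bounded x M -> rnorm (sum x) <= M.
Proof.
move=> xM; rewrite -rnormN -sub0r; apply: (cvg_rnorm_le (abs_bounded_cvg xM)).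
exists fset0 => // A _; rewrite sub0r rnormN partial_sumE.
by rewrite (le_trans (rnorm_sum _ _ _)).
Qed.

Lemma sumP (a : R[i]) x y :
  cvg (partial_sum x @ totally) -> cvg (partial_sum y @ totally) ->
  sum (fun i => a *: x i + y i) = a *: sum x + sum y.
Proof.
move=> cx cy; apply: cvg_lim => //.
rewrite (_ : partial_sum _ = (fun A => a *: partial_sum x A + partial_sum y A)).
  by apply: cvgD; [apply: cvgZ; [exact: cvg_cst|exact: cx]|exact: cy].
by apply/funext => A; rewrite /partial_sum big_split/= scaler_sumr.
Qed.

Lemma sum_single x (k : I) : (forall i, i != k -> x i = 0) -> sum x = x k.
Proof.
move=> x0; apply: lim_near_cst => //; exists [fset k]%fset => // A /= kA.
have {}kA : k \in A by rewrite (fsubsetP kA)// inE.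
rewrite partial_sumE (big_fsetD1 k)//= big_seq_cond big1 ?addr0// => i.
by rewrite andbT !inE => /andP[/x0 ->].
Qed.

End AbsolutelyConvergent.

(** Bounded additive maps commute with unordered sums. Only additivity is asked
    for because the map is also instantiated with the adjunction, which is
    conjugate-linear. *)
Lemma sum_morph (R : realType) (I : choiceType) (V W : completeNormedModType R[i])
    (L : V -> W) (C : R) (x : I -> V) :
  {morph L : u v / u + v} -> (forall v, rnorm (L v) <= C * rnorm v) ->
  cvg (partial_sum x @ totally) -> sum (L \o x) = L (sum x).
Proof.
move=> LD LC cx; have L0 : L 0 = 0 by apply: (addIr (L 0)); rewrite -LD !add0r.
have LN v : L (- v) = - L v by apply: (addIr (L v)); rewrite -LD !addNr.
apply: cvg_lim => //; apply/cvg_rnormP => e e0.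
move/cvg_rnormP : cx => /(_ _ (divr_gt0 e0 (ltr_wpDl (normr_ge0 C) ltr01))).
apply: filterS => A; rewrite ltr_pdivlMr ?ltr_wpDl// => xe.
rewrite partial_sumE -(big_morph L LD L0) -LN -LD -partial_sumE.
rewrite (le_lt_trans (LC _))// (le_lt_trans _ xe)// mulrC.
by rewrite ler_wpM2l ?rnorm_ge0// (le_trans (ler_norm C))// lerDl.
Qed.

Section Fubini.
Variables (R : realType) (I J : choiceType) (V : completeNormedModType R[i]).
Variables (x : I -> J -> V) (M : R).
Hypothesis xM : forall (A : {fset I}) (B : {fset J}),
  \sum_(i <- A) \sum_(j <- B) rnorm (x i j) <= M.

Lemma abs_bounded_row i : abs_bounded (x i) M.
Proof. by move=> B; have := xM [fset i]%fset B; rewrite big_seq_fset1. Qed.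

(** For a fixed finite set of rows, the rectangles over it exhaust these rows;
    so an estimate that holds for all large finite sets of pairs passes to the
    limit first along the rows and then over the set of rows. *)
Lemma iterated_sum_close (t : V) (F0 : {fset I * J}) (e : R) :
  cvg (partial_sum (fun i => sum (x i)) @ totally) ->
  (forall F : {fset I * J}, (F0 `<=` F)%fset ->
    rnorm (t - \sum_(p <- F) x p.1 p.2) <= e) ->
  rnorm (t - sum (fun i => sum (x i))) <= e.
Proof.
move=> cx te; apply: (cvg_rnorm_le cx).
exists [fset p.1 | p in F0]%fset => // A /= F0A; rewrite partial_sumE.
have lim_rows : (fun B => \sum_(i <- A) partial_sum (x i) B) @ totally
    --> \sum_(i <- A) sum (x i).
  apply: cvg_big => [|i _]; first exact: add_continuous.
  exact: abs_bounded_cvg (@abs_bounded_row i).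
apply: (cvg_rnorm_le lim_rows); exists [fset p.2 | p in F0]%fset => // B /= F0B.
under eq_bigr do rewrite partial_sumE.
rewrite -big_fsetM; apply: te; apply/fsubsetP => p pF0; rewrite in_fsetM.
by rewrite (fsubsetP F0A) ?(fsubsetP F0B)//; apply/imfsetP; exists p.
Qed.

Lemma abs_bounded_uncurry : abs_bounded (fun p => x p.1 p.2) M.
Proof.
move=> F; pose A := [fset p.1 | p in F]%fset; pose B := [fset p.2 | p in F]%fset.
have FAB : (F `<=` A `*` B)%fset.
  apply/fsubsetP => p pF; rewrite in_fsetM; apply/andP.
  by split; apply/imfsetP; exists p.
rewrite (le_trans _ (xM A B))//.
rewrite -(big_fsetM (fun i j => rnorm (x i j))) (sum_fsetD _ FAB).
by rewrite lerDl sumr_ge0// => p _; exact: rnorm_ge0.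
Qed.

End Fubini.

(** Both iterated sums are within [e / 2] of the sum over one large finite set
    of pairs, which does not depend on the order of summation. *)
Lemma sum_exchange (R : realType) (I J : choiceType)
    (V : completeNormedModType R[i]) (x : I -> J -> V) (M : R) :
  (forall (A : {fset I}) (B : {fset J}),
     \sum_(i <- A) \sum_(j <- B) rnorm (x i j) <= M) ->
  cvg (partial_sum (fun i => sum (x i)) @ totally) ->
  cvg (partial_sum (fun j => sum (fun i => x i j)) @ totally) ->
  sum (fun i => sum (x i)) = sum (fun j => sum (fun i => x i j)).
Proof.
move=> xM cx cx'; apply: rnorm_le_eps_eq => e e0.
have xM' (B : {fset J}) (A : {fset I}) :
    \sum_(j <- B) \sum_(i <- A) rnorm (x i j) <= M by rewrite exchange_big.
have [F0 F0e] := abs_bounded_tail (abs_bounded_uncurry xM) (divr_gt0 e0 (ltr0n _ 2)).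
pose t := partial_sum (fun p => x p.1 p.2) F0.
have t1 : rnorm (t - sum (fun i => sum (x i))) <= e / 2.
  apply: (iterated_sum_close (F0 := F0) xM cx) => F F0F.
  apply: ltW; rewrite -(partial_sumE (fun p => x p.1 p.2)).
  exact: (F0e _ F0F).
have t2 : rnorm (t - sum (fun j => sum (fun i => x i j))) <= e / 2.
  apply: (@iterated_sum_close _ _ _ _ (fun j i => x i j) _ xM' _
    [fset (p.2, p.1) | p in F0]%fset _ cx') => F F0F.
  pose F' := [fset (p.2, p.1) | p in F]%fset.
  have -> : \sum_(p <- F) x p.2 p.1 = partial_sum (fun p => x p.1 p.2) F'.
    by rewrite partial_sumE /F' big_imfset//= => -[? ?] [? ?] _ _ [-> ->].
  apply/ltW/(F0e F')/fsubsetP => -[i j] ijF0; apply/imfsetP.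
  exists (j, i) => //=; apply: (fsubsetP F0F); apply/imfsetP.
  by exists (i, j).
rewrite (le_trans (rnorm_distD t _ _))// rnorm_dist.
by rewrite (le_trans (lerD t1 t2))//; lra.
Qed.

(** * Riesz representation and adjoints *)

Lemma rnormM (R : realType) (a b : R[i]) : rnorm (a * b) = rnorm a * rnorm b.
Proof. by apply: complexI; rewrite rmorphM/= !rnormE normrM. Qed.

Section HilbertTheory.
Variables (R : realType) (H : hilbertType R).
Implicit Types (u v w x y z : H) (a : R[i]).

Lemma innerDl x y z : inner (x + y) z = inner x z + inner y z.
Proof. by rewrite linearDl. Qed.

Lemma innerDr x y z : inner x (y + z) = inner x y + inner x z.
Proof. by rewrite linearDr. Qed.

Lemma innerBl x y z : inner (x - y) z = inner x z - inner y z.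
Proof. by rewrite linearBl. Qed.

Lemma innerBr x y z : inner x (y - z) = inner x y - inner x z.
Proof. by rewrite linearBr. Qed.

Lemma innerZl a x y : inner (a *: x) y = a * inner x y.
Proof. by rewrite linearZl_LR. Qed.

Lemma innerZr a x y : inner x (a *: y) = Num.conj a * inner x y.
Proof. by rewrite linearZr_LR. Qed.

Lemma innerC x y : inner x y = Num.conj (inner y x).
Proof. by rewrite hermC expr0 mul1r. Qed.

Lemma inner_sqr x : inner x x = ((rnorm x ^+ 2)%:C)%C.
Proof. by rewrite inner_norm -rnormE rmorphXn. Qed.

Lemma rnorm_inner_sqr x : rnorm (inner x x) = rnorm x ^+ 2.
Proof.
by apply: complexI; rewrite -inner_sqr rnormE ger0_norm//.
Qed.

Lemma inner_nondeg x y : (forall z, inner z x = inner z y) -> x = y.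
Proof.
move=> xy; apply/eqP; rewrite -subr_eq0 -rnorm_eq0 -(sqrf_eq0 (rnorm _)).
by rewrite -(inj_eq (@complexI R)) -inner_sqr innerBr xy subrr.
Qed.

(** Pythagoras for the projection of [u] onto the line of [w]. The Cauchy-Schwarz
    inequality and the orthogonality in the representation theorem below both
    follow from it. *)
Lemma inner_decomposition u w : exists a,
  inner u w = a * inner w w /\
  rnorm u ^+ 2 = rnorm (u - a *: w) ^+ 2 + (rnorm a * rnorm w) ^+ 2.
Proof.
have [->|w0] := eqVneq w 0.
  exists 0; rewrite linear0r mul0r; split => //.
  by rewrite scale0r subr0 rnorm0 mulr0 expr0n addr0.
have ww0 : inner w w != 0 by rewrite dnorm_eq0.
exists (inner u w / inner w w); split; first by rewrite divfK.
set a := _ / _; have orth : inner (u - a *: w) (a *: w) = 0.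
  by rewrite innerZr innerBl innerZl divfK// subrr mulr0.
have : inner u u = inner (u - a *: w) (u - a *: w) + inner (a *: w) (a *: w).
  by rewrite -(hnormDd orth) subrK.
by rewrite !inner_sqr -rmorphD rnormZ => /complexI.
Qed.

Lemma inner_CauchySchwarz x y : rnorm (inner x y) <= rnorm x * rnorm y.
Proof.
have [a [-> xE]] := inner_decomposition x y.
rewrite rnormM rnorm_inner_sqr mulrA.
rewrite ler_wpM2r ?rnorm_ge0// -(@ler_pXn2r _ 2)// ?nnegrE ?mulr_ge0 ?rnorm_ge0//.
by rewrite xE lerDr sqr_ge0.
Qed.

Lemma parallelogram x y :
  rnorm (x + y) ^+ 2 + rnorm (x - y) ^+ 2 = 2 * rnorm x ^+ 2 + 2 * rnorm y ^+ 2.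
Proof.
have : inner (x + y) (x + y) + inner (x - y) (x - y) =
    (inner x x + inner x x) + (inner y y + inner y y).
  rewrite innerBl innerDl !innerBr !innerDr; ring.
by rewrite !inner_sqr -!rmorphD => /complexI ->; ring.
Qed.

Section Riesz.
Variables (phi : H -> R[i]) (M : R).
Hypothesis phiP : forall a x y, phi (a *: x + y) = a * phi x + phi y.
Hypothesis phiM : forall x, rnorm (phi x) <= M * rnorm x.

Let phi0 : phi 0 = 0.
Proof.
by have := phiP 1 0 0; rewrite scaler0 mul1r addr0 -[LHS]addr0 => /addrI.
Qed.

Let phiZ a x : phi (a *: x) = a * phi x.
Proof. by rewrite -[a *: x]addr0 phiP phi0 addr0. Qed.

Let phiD x y : phi (x + y) = phi x + phi y.
Proof. by rewrite -[x in LHS]scale1r phiP mul1r. Qed.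

Let phiB x y : phi (x - y) = phi x - phi y.
Proof. by rewrite addrC -scaleN1r phiP mulN1r addrC. Qed.

(** By the parallelogram identity two almost minimal vectors of the hyperplane
    [phi = 1] are close to each other, because their midpoint is again in the
    hyperplane. So the filter generated by the sets of almost minimal vectors is
    Cauchy, and its limit is minimal. *)
Lemma exists_minimizer : (exists x, phi x != 0) ->
  exists2 u, phi u = 1 & forall x, phi x = 1 -> rnorm u <= rnorm x.
Proof.
move=> [x0 phix0]; pose S := [set rnorm x | x in [set x | phi x = 1]].
have infS : has_inf S.
  split; last by exists 0 => _ [x _ <-]; exact: rnorm_ge0.
  exists (rnorm ((phi x0)^-1 *: x0)), ((phi x0)^-1 *: x0) => //=.
  by rewrite phiZ mulVf.
pose delta := inf S.
have delta_le x : phi x = 1 -> delta <= rnorm x.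
  by move=> x1; apply: (inf_lbound infS.2); exists x.
have delta0 : 0 <= delta by apply: lb_le_inf infS.1 _ => _ [x _ <-]; exact: rnorm_ge0.
pose C (e : R) := [set x | phi x = 1 /\ rnorm x < delta + e].
pose F := filter_from [set e : R | 0 < e] C.
have FF : ProperFilter F.
  apply: filter_from_proper => [|e e0].
    apply: filter_from_filter => [|e1 e2 e10 e20]; first by exists 1 => /=.
    exists (Num.min e1 e2) => /=; first by rewrite lt_min e10.
    by move=> x [x1]; rewrite -ltrBlDl lt_min !ltrBlDl => /andP[].
  have [_ [x x1 <-] xe] := inf_adherent e0 infS.
  by exists x; split.
(* The parallelogram identity gives [4 * ((delta + e) ^+ 2 - delta ^+ 2)], and
   [e ^+ 2 <= e]. *)
have close e x y : 0 < e -> e <= 1 -> C e x -> C e y ->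
    rnorm (x - y) ^+ 2 <= (8 * delta + 4) * e.
  move=> e0 e1 [x1 xe] [y1 ye].
  have mid : 2 * delta <= rnorm (x + y).
    have := delta_le (2^-1 *: (x + y)); rewrite phiZ phiD x1 y1.
    rewrite mulVf ?pnatr_eq0// => /(_ erefl); rewrite rnormZ (_ : rnorm _ = 2^-1).
      by rewrite ler_pdivlMl.
    apply: complexI; rewrite rnormE ger0_norm ?invr_ge0// fmorphV rmorph_nat//.
  have mid2 : (2 * delta) ^+ 2 <= rnorm (x + y) ^+ 2.
    by rewrite ler_pXn2r ?nnegrE ?rnorm_ge0 ?mulr_ge0.
  have x2 : rnorm x ^+ 2 <= (delta + e) ^+ 2.
    by rewrite ler_pXn2r ?nnegrE ?rnorm_ge0 ?addr_ge0 ?(ltW e0)// ltW.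
  have y2 : rnorm y ^+ 2 <= (delta + e) ^+ 2.
    by rewrite ler_pXn2r ?nnegrE ?rnorm_ge0 ?addr_ge0 ?(ltW e0)// ltW.
  have ee : e ^+ 2 <= e by rewrite expr2 ler_piMr// ltW.
  have := parallelogram x y; move: mid2 x2 y2 ee; rewrite !sqrrD !exprMn; lra.
have Fu : cvg F.
  apply: cauchy_cvg; apply/cauchy_rnormP => e e0.
  (* The constant 5 in place of 4 makes the final comparison strict. *)
  pose d := Num.min 1 (e ^+ 2 / (8 * delta + 5)).
  have d5 : 0 < 8 * delta + 5 by rewrite ltr_wpDl ?mulr_ge0.
  have d0 : 0 < d by rewrite lt_min ltr01 divr_gt0// exprn_gt0.
  have [x xd] := filter_ex (ex_intro2 _ _ d d0 (@subset_refl _ _) : F (C d)).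
  exists x; exists d => // y yd.
  rewrite -(@ltr_pXn2r _ 2)// ?nnegrE ?rnorm_ge0 ?(ltW e0)//.
  have d1 : d <= 1 by rewrite ge_min lexx.
  apply: le_lt_trans (close _ _ _ d0 d1 xd yd) _.
  apply: (@lt_le_trans _ _ ((8 * delta + 5) * d)).
    by rewrite ltr_pM2r// ltrD2l ltr_nat.
  by rewrite -ler_pdivlMl// mulrC ge_min lexx orbT.
have Flt e : 0 < e -> F (C e) by exists e.
pose u := lim F; have M0 : 0 <= `|M| + 1 by rewrite addr_ge0.
exists u => [|x /delta_le]; last first.
  apply: le_trans; rewrite -rnormN -sub0r; apply/ler_addgt0Pr => e e0.
  apply: (@cvg_rnorm_le _ _ _ F _ id _ _ _ Fu).
  by apply: filterS (Flt e e0) => y [_ /ltW]; rewrite sub0r rnormN.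
have /cvg_rnormP {}Fu : id @ F --> u by exact: Fu.
apply: (@rnorm_le_eps_eq R R[i]^o) => e e0.
have eM : 0 < e / (`|M| + 1) by rewrite divr_gt0// ltr_wpDl.
have [y [/= ye [y1 _]]] := filter_ex (filterI (Fu _ eM) (Flt 1 ltr01)).
rewrite -y1 -phiB (le_trans (phiM _))//.
move: ye; rewrite ltr_pdivlMr ?ltr_wpDl// => /ltW; apply: le_trans.
rewrite mulrC ler_wpM2l ?rnorm_ge0// (le_trans (ler_norm M))// lerDl//.
Qed.

(** A minimal vector [u] of the hyperplane [phi = 1] is orthogonal to the kernel
    of [phi]: subtracting from [u] its component along a vector of the kernel
    stays in the hyperplane and cannot decrease the norm. Then [x - phi x *: u] lies
    in the kernel, which determines [phi x] from [inner x u]. *)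
Lemma riesz : exists z, forall x, phi x = inner x z.
Proof.
have [/exists_minimizer[u u1 umin]|] := pselect (exists x, phi x != 0); last first.
  move=> /forallNP phi_eq0; exists 0 => x; rewrite linear0r.
  by apply/eqP/negPn/negP/phi_eq0.
have orth w : phi w = 0 -> inner u w = 0.
  move=> w0; have [a [-> uE]] := inner_decomposition u w.
  have : rnorm u ^+ 2 <= rnorm (u - a *: w) ^+ 2.
    rewrite ler_pXn2r ?nnegrE ?rnorm_ge0// umin//.
    by rewrite phiB phiZ w0 mulr0 subr0.
  rewrite uE gerDl => aw; have : (rnorm a * rnorm w) ^+ 2 = 0.
    by apply/eqP; rewrite eq_le aw sqr_ge0.
  move=> /eqP; rewrite sqrf_eq0 mulf_eq0 => /orP[|].
    by rewrite (@rnorm_eq0 R R[i]^o) => /eqP ->; rewrite mul0r.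
  by rewrite rnorm_eq0 => /eqP ->; rewrite linear0r mulr0.
have uu0 : inner u u != 0.
  rewrite dnorm_eq0; apply/eqP => u0; move: u1; rewrite u0 phi0 => /eqP.
  by rewrite eq_sym oner_eq0.
exists ((Num.conj (inner u u))^-1 *: u) => x.
have := orth (x - phi x *: u); rewrite phiB phiZ u1 mulr1 subrr => /(_ erefl).
move=> /(congr1 Num.conj); rewrite -innerC rmorph0 innerBl innerZl.
move=> /eqP; rewrite subr_eq0 => /eqP xu.
by rewrite innerZr fmorphV/= conjCK xu mulrC mulfK.
Qed.

End Riesz.

Implicit Types f g h : boundedOp H.

(** Apply the Cauchy-Schwarz inequality to [inner (g y) (g y) = inner (f (g y)) y]
    and cancel one factor. *)
Lemma inner_adjoint_le f (g : H -> H) :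
  (forall x y, inner (f x) y = inner x (g y)) ->
  forall y, rnorm (g y) <= rnorm f * rnorm y.
Proof.
move=> fg y; have [->|] := eqVneq (g y) 0.
  by rewrite rnorm0 mulr_ge0 ?rnorm_ge0.
rewrite -rnorm_gt0 => gy0; rewrite -(ler_pM2l gy0).
have <- : rnorm (inner (g y) (g y)) = rnorm (g y) * rnorm (g y).
  by rewrite rnorm_inner_sqr.
rewrite -fg (le_trans (inner_CauchySchwarz _ _))// mulrA ler_wpM2r ?rnorm_ge0//.
by rewrite mulrC boundedOp_ub.
Qed.

Lemma adjoint_exists f : exists g, forall x y, inner (f x) y = inner x (g y).
Proof.
have : forall y, exists z, forall x, inner (f x) y = inner x z.
  move=> y; apply: (@riesz _ (rnorm f * rnorm y)) => [a x x'|x].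
    by rewrite linearP innerDl innerZl.
  rewrite (le_trans (inner_CauchySchwarz _ _))// mulrAC.
  by rewrite ler_wpM2r ?rnorm_ge0// boundedOp_ub.
move=> /choice[g gP].
have gb : g \in @bounded_op _ H.
  apply/bounded_opP; split=> [a y y'|].
    apply: inner_nondeg => x.
    by rewrite innerDr innerZr -!gP innerDr innerZr.
  exists ((rnorm f)%:C)%C => y; rewrite -!rnormE -rmorphM lecR.
  exact: (inner_adjoint_le (f := f)).
by exists (BoundedOp gb) => x y; rewrite gP.
Qed.

(** The set in the definition of [adjoint] is not empty, so the chosen element
    has the defining property. *)
Lemma adjointP f x y : inner (f x) y = inner x (adjoint f y).
Proof.
have [g gP] := adjoint_exists f.
exact: (@xgetPex _ 0 [set g : boundedOp H | forall x y, inner (f x) y = inner x (g y)]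
  (ex_intro _ g gP)).
Qed.

Lemma adjoint_unique f g :
  (forall x y, inner (f x) y = inner x (g y)) -> adjoint f = g.
Proof.
move=> fg; apply/boundedOpE => y; apply: inner_nondeg => x.
by rewrite -adjointP fg.
Qed.

Lemma adjointK : involutive (@adjoint R H).
Proof.
by move=> f; apply: adjoint_unique => x y; rewrite innerC -adjointP -innerC.
Qed.

Lemma adjointPZ a f g :
  adjoint (a *: f + g) = Num.conj a *: adjoint f + adjoint g.
Proof.
apply: adjoint_unique => x y.
by rewrite /= innerDl innerZl innerDr innerZr conjCK -!adjointP.
Qed.

Lemma adjointD : {morph @adjoint R H : f g / f + g}.
Proof. by move=> f g; rewrite -[f]scale1r adjointPZ rmorph1 !scale1r. Qed.

Lemma adjoint_comp f g : adjoint (op_comp f g) = op_comp (adjoint g) (adjoint f).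
Proof. by apply: adjoint_unique => x y; rewrite /= -!adjointP. Qed.

Lemma rnorm_adjoint f : rnorm (adjoint f) = rnorm f.
Proof.
have le h : rnorm (adjoint h) <= rnorm h.
  apply: boundedOp_le => [|y]; first exact: rnorm_ge0.
  exact/inner_adjoint_le/adjointP.
by apply/eqP; rewrite eq_le le -{1}(adjointK f) le.
Qed.

End HilbertTheory.

(** * Polynomial weights and Riemann series *)

Section EuclideanNorm.
Variables (R : realType) (d : nat).
Implicit Types x y z : 'rV[R]_d.

Lemma euclidean_norm_ge0 x : 0 <= euclidean_norm x.
Proof. exact: sqrtr_ge0. Qed.

Lemma euclidean_norm_sqr x : euclidean_norm x ^+ 2 = \sum_(i < d) x ord0 i ^+ 2.
Proof. by rewrite sqr_sqrtr// sumr_ge0// => i _; exact: sqr_ge0. Qed.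

Lemma euclidean_normN x : euclidean_norm (- x) = euclidean_norm x.
Proof. by congr Num.sqrt; apply: eq_bigr => i _; rewrite mxE sqrrN. Qed.

Lemma coord_le_euclidean_norm x i : `|x ord0 i| <= euclidean_norm x.
Proof.
rewrite -sqrtr_sqr ler_sqrt; last by apply: sumr_ge0 => j _; exact: sqr_ge0.
by rewrite (bigD1 i)//= lerDl sumr_ge0// => j _; exact: sqr_ge0.
Qed.

Lemma euclidean_inner_le x y :
  \sum_(i < d) x ord0 i * y ord0 i <= euclidean_norm x * euclidean_norm y.
Proof.
have [x0|x0] := eqVneq (euclidean_norm x) 0.
  rewrite x0 mul0r big1// => i _; have := coord_le_euclidean_norm x i.
  by rewrite x0 normr_le0 => /eqP ->; rewrite mul0r.
have [y0|y0] := eqVneq (euclidean_norm y) 0.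
  rewrite y0 mulr0 big1// => i _; have := coord_le_euclidean_norm y i.
  by rewrite y0 normr_le0 => /eqP ->; rewrite mulr0.
set a := euclidean_norm x in x0 *; set b := euclidean_norm y in y0 *.
have ab0 : 0 < a * b by rewrite mulr_gt0// lt_def euclidean_norm_ge0 ?x0 ?y0.
have : 0 <= \sum_(i < d) (b * x ord0 i - a * y ord0 i) ^+ 2.
  by apply: sumr_ge0 => i _; exact: sqr_ge0.
have -> : \sum_(i < d) (b * x ord0 i - a * y ord0 i) ^+ 2 =
    2 * (a * b) * (a * b - \sum_(i < d) x ord0 i * y ord0 i).
  transitivity (b ^+ 2 * (\sum_(i < d) x ord0 i ^+ 2)
      + a ^+ 2 * (\sum_(i < d) y ord0 i ^+ 2)
      - 2 * (a * b) * \sum_(i < d) x ord0 i * y ord0 i).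
    rewrite !mulr_sumr -big_split/= -sumrB; apply: eq_bigr => i _; ring.
  by rewrite -!euclidean_norm_sqr -/a -/b; ring.
by rewrite pmulr_rge0 ?subr_ge0// mulr_gt0.
Qed.

Lemma euclidean_normD x y :
  euclidean_norm (x + y) <= euclidean_norm x + euclidean_norm y.
Proof.
rewrite -(@ler_pXn2r _ 2)// ?nnegrE ?addr_ge0 ?euclidean_norm_ge0//.
rewrite sqrrD !euclidean_norm_sqr.
under eq_bigr do rewrite mxE sqrrD.
by rewrite !big_split/= lerD2r lerD2l mulr2n lerD// euclidean_inner_le.
Qed.

End EuclideanNorm.

Section Weight.
Variables (R : realType) (d : nat) (s : R).
Implicit Types x y z : 'rV[R]_d.

Lemma nu_gt0 x : 0 < nu s x.
Proof. by rewrite powR_gt0// ltr_wpDr ?euclidean_norm_ge0. Qed.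

Lemma nuV_ge0 x : 0 <= (nu s x)^-1.
Proof. by rewrite invr_ge0 ltW// nu_gt0. Qed.

Lemma nu_dist x y : nu s (x - y) = nu s (y - x).
Proof. by rewrite /nu -[in RHS]opprB euclidean_normN. Qed.

Lemma nu0 : nu s (0 : 'rV[R]_d) = 1.
Proof.
rewrite /nu /euclidean_norm big1 ?sqrtr0 ?addr0 ?powR1// => i _.
by rewrite mxE expr0n.
Qed.

(** From [1 + |x + y| <= 2 * max (1 + |x|, 1 + |y|)]. *)
Lemma nu_quasi_triangle x y : 0 <= s ->
  nu s (x + y) <= 2 `^ s * Num.max (nu s x) (nu s y).
Proof.
move=> s0; pose e := Num.max (euclidean_norm x) (euclidean_norm y).
have -> : Num.max (nu s x) (nu s y) = (1 + e) `^ s.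
  rewrite /e /nu; wlog xy : x y {e} / euclidean_norm x <= euclidean_norm y => [W|].
    have /orP[/W//|/W] := le_total (euclidean_norm x) (euclidean_norm y).
    by rewrite maxC => ->; rewrite maxC.
  rewrite !max_r//; apply: ge0_ler_powR => //.
  - by rewrite nnegrE addr_ge0 ?euclidean_norm_ge0.
  - by rewrite nnegrE addr_ge0 ?euclidean_norm_ge0.
  - by rewrite lerD2l.
have e0 : 0 <= e by rewrite le_max euclidean_norm_ge0.
rewrite -powRM ?addr_ge0//; apply: ge0_ler_powR => //.
- by rewrite nnegrE addr_ge0 ?euclidean_norm_ge0.
- by rewrite nnegrE mulr_ge0 ?addr_ge0.
have := euclidean_normD x y.
have : euclidean_norm x <= e by rewrite le_max lexx.
have : euclidean_norm y <= e by rewrite le_max lexx orbT.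
lra.
Qed.

(** In the product the larger of the two weights can be compared with the weight
    of the sum; the other one survives. This is the reason why polynomial weights
    are subconvolutive as soon as their inverses are summable. *)
Lemma nuV_mul_le x y : 0 <= s ->
  (nu s x)^-1 * (nu s y)^-1 <=
  2 `^ s * ((nu s x)^-1 + (nu s y)^-1) * (nu s (x + y))^-1.
Proof.
move=> s0; have h2 : 0 <= 2 `^ s :> R by exact: powR_ge0.
have := nu_quasi_triangle x y s0; have := nu_gt0 (x + y).
move: (nu_gt0 x) (nu_gt0 y); move: (nu s x) (nu s y) (nu s (x + y)) => a b c.
wlog ab : a b / a <= b => [W a0 b0 c0 cab|a0 b0 c0].
  have /orP[ab|ba] := le_total a b; first exact: W.
  by rewrite mulrC (addrC a^-1) W// maxC.
rewrite max_r// => cb; rewrite mulrDr mulrDl -[leLHS]addr0 lerD//; last first.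
  by rewrite !mulr_ge0// invr_ge0 ltW.
rewrite -[leRHS]mulrA (mulrCA (2 `^ s)) ler_wpM2l ?invr_ge0 ?(ltW a0)//.
by rewrite ler_pdivlMr// mulrC ler_pdivrMr.
Qed.

End Weight.

Section RiemannSeries.
Variables (R : realType) (p : R).
Hypothesis p1 : 1 < p.

Let g (m : nat) : R := (m.+1%:R `^ p)^-1.

Let g_ge0 m : 0 <= g m. Proof. by rewrite invr_ge0 powR_ge0. Qed.

(** The terms of indices [2m + 1] and [2m + 2], for [m < M], are each at most
    [2 `^ - p] times the term of index [m]. *)
Lemma riemann_sum_doubling (M : nat) :
  \sum_(m < M.*2.+1) g m <= 1 + 2 * (2 `^ p)^-1 * \sum_(m < M) g m.
Proof.
have p0 : 0 <= p by rewrite ltW// (lt_trans ltr01).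
elim: M => [|M IH]; first by rewrite big_ord_recl !big_ord0 /g powR1 invr1 mulr0.
rewrite doubleS 2!big_ord_recr/= [in leRHS]big_ord_recr/= mulrDr addrA -addrA lerD//.
have -> : g M.*2.+1 = (2 `^ p)^-1 * g M.
  rewrite /g -invfM -powRM// -natrM; congr ((_%:R `^ _)^-1); lia.
rewrite -mulrA mulr_natl [X in _ <= X]mulr2n lerD2l /g -invfM -powRM// -natrM.
rewrite lef_pV2 ?posrE ?powR_gt0 ?ltr0n//; apply: ge0_ler_powR; rewrite ?nnegrE//.
by rewrite ler_nat; lia.
Qed.

(** The sum [S M] of the first [M] terms satisfies [S M <= S (2M + 1)], so that
    the doubling estimate reads [S M <= 1 + q * S M] with [q = 2 `^ (1 - p) < 1]. *)
Lemma riemann_sum_bounded :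
  exists2 C : R, 0 <= C & forall M : nat, \sum_(m < M) g m <= C.
Proof.
have q1 : 2 * (2 `^ p)^-1 < 1 :> R.
  rewrite ltr_pdivrMr ?powR_gt0// mul1r -mulr_powRB1// ?(lt_trans ltr01)//.
  have : 1 `^ (p - 1) < 2 `^ (p - 1) :> R.
    by apply: gt0_ltr_powR; rewrite ?subr_gt0 ?nnegrE ?ltr1n.
  by rewrite powR1 -ltr_pdivrMl// mulVf.
have c0 : 0 < 1 - 2 * (2 `^ p)^-1 :> R by rewrite subr_gt0.
exists (1 - 2 * (2 `^ p)^-1)^-1 => [|M]; first by rewrite invr_ge0 ltW.
rewrite -[leRHS]mul1r ler_pdivlMr// mulrBr mulr1 lerBlDr [in leRHS]mulrC.
apply: le_trans (riemann_sum_doubling M); rewrite -addnn -addnS.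
by rewrite big_split_ord/= lerDl sumr_ge0.
Qed.

End RiemannSeries.

(** * Summability of the weights on a relatively separated set *)

(** Sign and size of an integer, sized so that [-1] and [0] both get size 0: the
    half-open unit intervals starting at these two integers touch the origin. *)
Definition shell (z : int) : bool * nat :=
  match z with Posz m => (true, m) | Negz m => (false, m) end.

Lemma shell_inj : injective shell.
Proof.
by move=> [m|m] [n|n] e; have := congr1 fst e; have := congr1 snd e => /= ->.
Qed.

Lemma shell_le (R : realType) (t : R) :
  ((shell (Num.floor t)).2.+1)%:R <= 1 + `|t|.
Proof.
have := floor_le t; have := ltW (floorD1_gt t).
case: (Num.floor t) => m; rewrite /shell /= => tm mt.
  by rewrite -natr1 addrC lerD2l (le_trans mt)// ler_norm.
have {mt}tm : t <= - m%:R.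
  by rewrite (le_trans tm)// pmulrn -intrN ler_int NegzE; lia.
by rewrite -natr1 addrC lerD2l -normrN (le_trans _ (ler_norm _))// lerNr.
Qed.

Section Counting.
Local Open Scope card_scope.
Variables (R : realType) (d : nat) (X : set 'rV[R]_d).

Definition cell (k x : 'rV[R]_d) (i : 'I_d) : int :=
  Num.floor (x ord0 i - k ord0 i).

(** The points of one cell lie in a closed unit cube, whose corner is [k] moved
    by the integer vector [c]. *)
Lemma card_cell_le (N : nat) (k : 'rV[R]_d) (c : 'I_d -> int) (F : {fset X}) :
  (forall x : 'rV[R]_d,
    (X `&` [set y | forall i, (0 <= y ord0 i - x ord0 i <= 1)%R]) #<= `I_N) ->
  (forall x, x \in F -> cell k (val x) =1 c) -> (#|` F| <= N)%N.
Proof.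
move=> XN Fc; pose x0 := \row_i (k ord0 i + (c i)%:~R).
pose F' := [fset val x | x in F]%fset.
have <- : #|` F'| = #|` F| by rewrite card_imfset//=; exact: val_inj.
rewrite -(set_fsetK F'); apply: geq_card_fset_set; apply: card_le_trans (XN x0).
apply: subset_card_le => _ /= /imfsetP[x /= xF ->]; split.
  exact: set_valP.
move=> i; have := floor_itv (val x ord0 i - k ord0 i).
rewrite -/(cell k (val x) i) Fc// mxE opprD addrA intrD subr_ge0.
by move=> /andP[-> /ltW xc]; rewrite /= lerBlDl.
Qed.

(** Pick [p > 1] with [p * d <= s], and let [x] be the difference of a point and
    [k]. Since [1 + |x|] dominates each [1 + |x_i|], the inverse weight is at most the product over the coordinates of
    [(1 + |x_i|) `^ - p]. Grouping the points by the integer parts of their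
    coordinates, with at most [N] points in each cell, bounds the sum by [N] times
    the sum over integer vectors of a product of functions of one coordinate,
    which factors as the [d]-th power of a two-sided Riemann series. *)
Lemma sum_nuV_bounded (s : R) : relatively_separated X -> d%:R < s ->
  exists2 C : R, 0 <= C & forall (k : 'rV[R]_d) (F : {fset X}),
    \sum_(x <- F) (nu s (val x - k))^-1 <= C.
Proof.
(* The denominator [d + 1], in place of [d], covers the case [d = 0]. *)
move=> [N XN] ds; pose p := 1 + (s - d%:R) / d.+1%:R.
have sd : 0 < s - d%:R by rewrite subr_gt0.
have p1 : 1 < p by rewrite ltrDl divr_gt0.
have pds : p * d%:R <= s.
  rewrite mulrDl mul1r -lerBrDl mulrAC -mulrA ler_piMr ?(ltW sd)//.
  by rewrite ler_pdivrMr// mul1r ler_nat.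
have [C0 C00 gC0] := riemann_sum_bounded p1.
pose g (m : nat) : R := (m.+1%:R `^ p)^-1.
have g0 m : 0 <= g m by rewrite invr_ge0 powR_ge0.
pose C := N%:R * (2 * C0) ^+ d.
exists C => [|k F]; first by rewrite mulr_ge0// exprn_ge0// mulr_ge0.
have nu_prod (x : X) :
    (nu s (val x - k))^-1 <= \prod_(i < d) g (shell (cell k (val x) i)).2.
  rewrite prodfV lef_pV2 ?posrE ?nu_gt0 ?prodr_gt0//.
  have e1 : 1 <= 1 + euclidean_norm (val x - k) by rewrite lerDl euclidean_norm_ge0.
  apply: le_trans (ler_powR e1 pds); rewrite powRrM powR_mulrn ?powR_ge0//.
  rewrite -[X in _ ^+ X]card_ord -prodr_const; apply: ler_prod => i _.
  rewrite powR_ge0/=; apply: ge0_ler_powR; rewrite ?nnegrE ?ler0n ?(le_trans ler01)//.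
    by rewrite ltW// (lt_trans ltr01).
  rewrite (le_trans (shell_le _))// lerD2l.
  by have := coord_le_euclidean_norm (val x - k) i; rewrite !mxE.
(* Only finitely many cells are occupied; [M] bounds their coordinates. *)
pose M := (\max_(x <- F) \max_(i < d) (shell (cell k (val x) i)).2)%N.
have ltM x i : x \in F -> ((shell (cell k (val x) i)).2 < M.+1)%N.
  move=> xF; rewrite ltnS (leq_trans _ (leq_bigmax_seq _ xF _))//.
  exact: (@leq_bigmax _ (fun i => (shell (cell k (val x) i)).2)).
pose T := (bool * 'I_M.+1)%type.
pose key (x : X) : {ffun 'I_d -> T} :=
  [ffun i => ((shell (cell k (val x) i)).1, inord (shell (cell k (val x) i)).2)].
apply: (@le_trans _ _ (\sum_(x <- F) \prod_(i < d) g (key x i).2)).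
  rewrite !big_seq; apply: ler_sum => x xF; rewrite (le_trans (nu_prod x))//.
  by apply: ler_prod => i _; rewrite g0 ffunE/= inordK ?ltM.
rewrite (partition_big key xpredT)//=.
apply: (@le_trans _ _ (\sum_(c : {ffun 'I_d -> T}) N%:R * \prod_(i < d) g (c i).2)).
  apply: ler_sum => c _; rewrite (eq_bigr (fun=> \prod_(i < d) g (c i).2)); last first.
    by move=> x /eqP ->.
  rewrite big_const_seq iter_addr_0 -[leLHS]mulr_natl ler_wpM2r ?prodr_ge0//.
  rewrite ler_nat.
  have [|] := eqVneq (count (fun x => key x == c) F) 0%N; first by move=> ->.
  rewrite -lt0n -has_count => /hasP[x xF /eqP xc].
  have -> : count (fun x => key x == c) F = #|` [fset y in F | key y == c]%fset|.
    rewrite -size_filter; apply: perm_size; apply: uniq_perm.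
    - by rewrite filter_uniq// fset_uniq.
    - exact: fset_uniq.
    by move=> y; rewrite mem_filter !inE andbC.
  apply: (card_cell_le (k := k) (c := cell k (val x)) XN) => y.
  rewrite !inE => /andP[yF /eqP yc] i; apply: shell_inj.
  have := congr1 (fun h : {ffun 'I_d -> T} => h i) (etrans yc (esym xc)).
  rewrite !ffunE => -[e1 /(congr1 (@nat_of_ord _))]; rewrite !inordK ?ltM// => e2.
  by apply/eqP; rewrite /eq_op/= e1 e2 !eqxx.
rewrite -mulr_sumr ler_wpM2l// -(bigA_distr_bigA (fun _ (t : T) => g t.2)).
rewrite prodr_const card_ord lerXn2r ?nnegrE ?sumr_ge0 ?mulr_ge0//.
rewrite -(pair_bigA _ (fun (_ : bool) (m : 'I_M.+1) => g m))/= big_bool.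
by rewrite mulr_natl [leRHS]mulr2n; apply: lerD; exact: gC0.
Qed.

(** The pointwise estimate of the product of two inverse weights reduces the
    convolution to the uniformly bounded sums of inverse weights around [k] and
    around [l]. *)
Lemma nuV_convolution_bounded (s : R) : relatively_separated X -> d%:R < s ->
  exists2 C : R, 0 <= C & forall (k l : 'rV[R]_d) (F : {fset X}),
    \sum_(x <- F) (nu s (k - val x))^-1 * (nu s (val x - l))^-1 <=
    C * (nu s (k - l))^-1.
Proof.
move=> XN ds; have [C0 C00 CP] := sum_nuV_bounded XN ds.
have s0 : 0 <= s by rewrite ltW// (le_lt_trans _ ds).
exists (2 `^ s * (C0 + C0)) => [|k l F]; first by rewrite mulr_ge0 ?powR_ge0 ?addr_ge0.
apply: (@le_trans _ _ (\sum_(x <- F)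
    2 `^ s * ((nu s (val x - k))^-1 + (nu s (val x - l))^-1) * (nu s (k - l))^-1)).
  apply: ler_sum => x _; rewrite -[k - l](subrKA (val x)) -(nu_dist s k).
  exact: nuV_mul_le.
rewrite -mulr_suml -mulr_sumr ler_wpM2r ?nuV_ge0// ler_wpM2l ?powR_ge0//.
by rewrite big_split/= lerD.
Qed.

End Counting.

(** * The Jaffard algebra *)

(* The supremum of the empty set and of an unbounded set is 0, so sets of
   nonnegative reals need no separate treatment of the degenerate cases. *)
Section SupNonneg.
Variables (R : realType) (S : set R).

Lemma sup_nonneg : (forall r, S r -> 0 <= r) -> 0 <= sup S.
Proof.
move=> S0; have [supS|/sup_out -> //] := pselect (has_sup S).
have [r Sr] := supS.1.
by apply: (le_trans (S0 r Sr)); exact: sup_upper_bound.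
Qed.

Lemma sup_le_nonneg (M : R) : 0 <= M -> (forall r, S r -> r <= M) -> sup S <= M.
Proof.
move=> M0 SM; have [S0|/set0P/negP/negPn/eqP ->] := pselect (S !=set0).
  exact: ge_sup.
by rewrite sup0.
Qed.

End SupNonneg.

Section JaffardNorm.
Variables (R : realType) (d : nat) (X : set 'rV[R]_d) (H : hilbertType R).
Variable s : R.

Notation J := (Jaffard X H s).
Implicit Types (A B D : opmatrix X H) (k l : X) (a : R[i]).

Let w k l : R := (nu s (val k - val l))^-1.

Let w_ge0 k l : 0 <= w k l. Proof. exact: nuV_ge0. Qed.

Lemma opmatrixE A B : (forall k l, A k l = B k l) -> A = B.
Proof. by move=> AB; apply/funext => k; apply/funext => l. Qed.

Lemma normJ_ge0 A : 0 <= normJ s A.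
Proof.
apply: sup_nonneg => _ [kl _ <-].
by rewrite mulr_ge0 ?rnorm_ge0// ltW// nu_gt0.
Qed.

Lemma normJ_ub A k l : J A -> rnorm (A k l) <= normJ s A * w k l.
Proof.
move=> JA; rewrite ler_pdivlMr ?nu_gt0//.
by apply: (ub_le_sup JA); exists (k, l).
Qed.

Lemma normJ_le A (M : R) : 0 <= M ->
  (forall k l, rnorm (A k l) <= M * w k l) -> J A /\ normJ s A <= M.
Proof.
move=> M0 AM; have wAM r : weighted_entries s A r -> r <= M.
  by move=> [[k l] _ <-]; rewrite -ler_pdivlMr ?nu_gt0// AM.
by split; [exists M => r /wAM|exact: sup_le_nonneg].
Qed.

Lemma normJ_eq0 A : J A -> normJ s A = 0 -> A = 0.
Proof.
move=> JA A0; apply: opmatrixE => k l; apply/eqP; rewrite -rnorm_eq0.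
by rewrite eq_le rnorm_ge0 andbT (le_trans (normJ_ub _ _ JA))// A0 mul0r.
Qed.

Lemma Jaffard0 : J 0.
Proof.
apply: (proj1 (normJ_le (lexx 0) _)) => k l; rewrite mul0r.
by rewrite [0 k l]/(0 : boundedOp H) rnorm0.
Qed.

Lemma JaffardP a A B : J A -> J B ->
  J (a *: A + B) /\ normJ s (a *: A + B) <= rnorm a * normJ s A + normJ s B.
Proof.
move=> JA JB; apply: normJ_le => [|k l].
  by rewrite addr_ge0 ?mulr_ge0 ?rnorm_ge0 ?normJ_ge0.
rewrite mulrDl -mulrA (le_trans (rnormD _ _))// rnormZ.
by rewrite lerD ?normJ_ub// ler_wpM2l ?rnorm_ge0 ?normJ_ub.
Qed.

Lemma JaffardZ a A : J A -> J (a *: A).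
Proof. by move=> JA; rewrite -[_ *: _]addr0; apply: (JaffardP a JA Jaffard0).1. Qed.

Lemma JaffardB A B : J A -> J B -> J (A - B).
Proof.
by move=> JA JB; rewrite addrC -scaleN1r; apply: (JaffardP _ JB JA).1.
Qed.

Lemma normJD A B : J A -> J B -> normJ s (A + B) <= normJ s A + normJ s B.
Proof.
move=> JA JB; have [_] := JaffardP 1 JA JB; rewrite scale1r.
by rewrite {1}/rnorm normr1 mul1r.
Qed.

(** Applying the inequality to [a^-1] and [a *: A] gives the reverse inequality. *)
Lemma scale_norm_eq (N : opmatrix X H -> R) :
  (forall a A, J A -> N (a *: A) <= rnorm a * N A) -> (forall A, 0 <= N A) ->
  forall a A, J A -> N (a *: A) = rnorm a * N A.
Proof.
move=> NZ N0 a A JA; apply/eqP; rewrite eq_le NZ//=.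
have [->|a0] := eqVneq a 0; first by rewrite /rnorm normr0 mul0r.
have ra0 : 0 < rnorm a by rewrite rnorm_gt0.
rewrite -ler_pdivlMl//; have := NZ a^-1 _ (JaffardZ a JA).
rewrite scalerA mulVf// scale1r => /le_trans -> //.
suff -> : rnorm a^-1 = (rnorm a)^-1 by [].
by apply: complexI; rewrite rnormE fmorphV/= rnormE normfV.
Qed.

Lemma normJZ a A : J A -> normJ s (a *: A) = rnorm a * normJ s A.
Proof.
move: a A; apply: scale_norm_eq => [a A JA|A]; last exact: normJ_ge0.
apply: (proj2 (normJ_le _ _)) => [|k l].
  by rewrite mulr_ge0 ?rnorm_ge0 ?normJ_ge0.
by rewrite -mulrA rnormZ ler_wpM2l ?rnorm_ge0 ?normJ_ub.
Qed.

Lemma Jaffard_one : J (opmatrix_one X H) /\ normJ s (opmatrix_one X H) <= 1.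
Proof.
apply: normJ_le => // k l; rewrite mul1r /opmatrix_one.
case: eqP => [->|_]; last by rewrite rnorm0.
by rewrite /w subrr nu0 invr1 op_id_le1.
Qed.

Lemma Jaffard_star A : J A ->
  J (opmatrix_star A) /\ normJ s (opmatrix_star A) <= normJ s A.
Proof.
move=> JA; apply: normJ_le => [|k l]; first exact: normJ_ge0.
have -> : w k l = w l k by rewrite /w nu_dist.
by rewrite /opmatrix_star rnorm_adjoint; exact: normJ_ub.
Qed.

Lemma opmatrix_starK A : opmatrix_star (opmatrix_star A) = A.
Proof. by apply: opmatrixE => k l; exact: adjointK. Qed.

Lemma opmatrix_starP a A B : opmatrix_star (a *: A + B) =
  Num.conj a *: opmatrix_star A + opmatrix_star B.
Proof. by apply: opmatrixE => k l; exact: adjointPZ. Qed.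

Lemma opmatrix_mul1 A : opmatrix_mul (opmatrix_one X H) A = A.
Proof.
apply: opmatrixE => k l; rewrite /opmatrix_mul (sum_single (k := k)).
  by rewrite /opmatrix_mul_term /opmatrix_one eqxx; exact/boundedOpE.
move=> n nk; rewrite /opmatrix_mul_term /opmatrix_one eq_sym (negPf nk).
exact/boundedOpE.
Qed.

Lemma opmatrix_mulr1 A : opmatrix_mul A (opmatrix_one X H) = A.
Proof.
apply: opmatrixE => k l; rewrite /opmatrix_mul (sum_single (k := l)).
  by rewrite /opmatrix_mul_term /opmatrix_one eqxx; exact/boundedOpE.
move=> n nl; rewrite /opmatrix_mul_term /opmatrix_one (negPf nl).
by apply/boundedOpE => x; rewrite op_compE linear0.
Qed.

Section Algebra.
(* The products are controlled by the weights through this estimate alone. *)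
Variable C : R.
Hypothesis C0 : 0 <= C.
Hypothesis convolution : forall k l (F : {fset X}),
  \sum_(n <- F) w k n * w n l <= C * w k l.

(** The entries are dominated by the weights, and the convolution of the weights
    is dominated by the weight. *)
Lemma opmatrix_mul_abs_bounded A B k l : J A -> J B ->
  abs_bounded (opmatrix_mul_term A B k l) (C * normJ s A * normJ s B * w k l).
Proof.
move=> JA JB F.
apply: (@le_trans _ _ (\sum_(n <- F) normJ s A * normJ s B * (w k n * w n l))).
  apply: ler_sum => n _; rewrite (le_trans (op_comp_le _ _))// mulrACA.
  by rewrite ler_pM ?rnorm_ge0 ?normJ_ub.
rewrite -mulr_sumr [leRHS](_ : _ = normJ s A * normJ s B * (C * w k l)); last by ring.
by rewrite ler_wpM2l ?mulr_ge0 ?normJ_ge0.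
Qed.

Lemma opmatrix_mul_converges A B : J A -> J B -> opmatrix_mul_cvg A B.
Proof.
by move=> JA JB k l; exact: abs_bounded_cvg (opmatrix_mul_abs_bounded k l JA JB).
Qed.

Lemma Jaffard_mul A B : J A -> J B ->
  J (opmatrix_mul A B) /\ normJ s (opmatrix_mul A B) <= C * normJ s A * normJ s B.
Proof.
move=> JA JB; apply: normJ_le => [|k l]; first by rewrite !mulr_ge0 ?normJ_ge0.
exact: abs_bounded_le (opmatrix_mul_abs_bounded k l JA JB).
Qed.

Lemma opmatrix_mulPl a A B D : J A -> J B -> J D ->
  opmatrix_mul (a *: A + B) D = a *: opmatrix_mul A D + opmatrix_mul B D.
Proof.
move=> JA JB JD; apply: opmatrixE => k l.
rewrite /opmatrix_mul -[RHS]/(a *: sum _ + sum _).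
rewrite -sumP; [|exact: opmatrix_mul_converges..].
by congr sum; apply/funext => n; exact: op_comp_linearl.
Qed.

Lemma opmatrix_mulPr a A B D : J A -> J B -> J D ->
  opmatrix_mul D (a *: A + B) = a *: opmatrix_mul D A + opmatrix_mul D B.
Proof.
move=> JA JB JD; apply: opmatrixE => k l.
rewrite /opmatrix_mul -[RHS]/(a *: sum _ + sum _).
rewrite -sumP; [|exact: opmatrix_mul_converges..].
by congr sum; apply/funext => n; exact: op_comp_linearr.
Qed.

Lemma opmatrix_mulZl a A D : J A -> J D ->
  opmatrix_mul (a *: A) D = a *: opmatrix_mul A D.
Proof.
move=> JA JD; have mul0 : opmatrix_mul 0 D = 0.
  have := opmatrix_mulPl 1 Jaffard0 Jaffard0 JD.
  by rewrite scaler0 addr0 scale1r -[LHS]addr0 => /addrI.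
by rewrite -[a *: A]addr0 (opmatrix_mulPl _ JA Jaffard0 JD) mul0 addr0.
Qed.

Lemma opmatrix_mulZr a A D : J A -> J D ->
  opmatrix_mul D (a *: A) = a *: opmatrix_mul D A.
Proof.
move=> JA JD; have mul0 : opmatrix_mul D 0 = 0.
  have := opmatrix_mulPr 1 Jaffard0 Jaffard0 JD.
  by rewrite scaler0 addr0 scale1r -[LHS]addr0 => /addrI.
by rewrite -[a *: A]addr0 (opmatrix_mulPr _ JA Jaffard0 JD) mul0 addr0.
Qed.

(** Both sides are iterated sums of [A k n B n m D m l], which is absolutely
    summable over the pairs [(n, m)] by two applications of the convolution
    estimate. *)
Lemma opmatrix_mulA A B D : J A -> J B -> J D ->
  opmatrix_mul A (opmatrix_mul B D) = opmatrix_mul (opmatrix_mul A B) D.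
Proof.
move=> JA JB JD; have [JAB _] := Jaffard_mul JA JB.
have [JBD _] := Jaffard_mul JB JD; apply: opmatrixE => k l.
pose x n m := op_comp (A k n) (op_comp (B n m) (D m l)).
have rowE : opmatrix_mul_term A (opmatrix_mul B D) k l = (fun n => sum (x n)).
  apply/funext => n; rewrite /opmatrix_mul_term /opmatrix_mul.
  rewrite -(@sum_morph _ _ _ _ (op_comp (A k n)) (rnorm (A k n))) //.
  - by move=> f g; rewrite -[f]scale1r op_comp_linearr !scale1r.
  - by move=> f; exact: op_comp_le.
  - exact: opmatrix_mul_converges.
have colE : opmatrix_mul_term (opmatrix_mul A B) D k l =
    (fun m => sum (fun n => x n m)).
  apply/funext => m; rewrite /opmatrix_mul_term /opmatrix_mul.
  rewrite -(@sum_morph _ _ _ _ (fun f => op_comp f (D m l)) (rnorm (D m l))) //.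
  - by congr sum; apply/funext => n; rewrite /x/= op_compA.
  - by move=> f g; rewrite -[f]scale1r op_comp_linearl !scale1r.
  - by move=> f; rewrite mulrC; exact: op_comp_le.
  - exact: opmatrix_mul_converges.
rewrite /opmatrix_mul -/(opmatrix_mul _ _) rowE colE.
apply: (@sum_exchange _ _ _ _ x
  (normJ s A * (C * normJ s B * normJ s D) * (C * w k l))).
- move=> F G.
  apply: (@le_trans _ _ (\sum_(n <- F)
    normJ s A * (C * normJ s B * normJ s D) * (w k n * w n l))).
    apply: ler_sum => n _; rewrite mulrACA.
    apply: (@le_trans _ _
      (rnorm (A k n) * \sum_(m <- G) rnorm (op_comp (B n m) (D m l)))).
      by rewrite mulr_sumr; apply: ler_sum => m _; exact: op_comp_le.
    rewrite ler_pM ?rnorm_ge0 ?sumr_ge0 ?normJ_ub//.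
      by move=> m _; exact: rnorm_ge0.
    exact: (opmatrix_mul_abs_bounded n l JB JD G).
  by rewrite -mulr_sumr ler_wpM2l ?convolution// !mulr_ge0 ?normJ_ge0.
- by rewrite -rowE; exact: opmatrix_mul_converges.
- by rewrite -colE; exact: opmatrix_mul_converges.
Qed.

Lemma opmatrix_starM A B : J A -> J B ->
  opmatrix_star (opmatrix_mul A B) = opmatrix_mul (opmatrix_star B) (opmatrix_star A).
Proof.
move=> JA JB; apply: opmatrixE => k l; rewrite /opmatrix_star /opmatrix_mul.
rewrite -(@sum_morph _ _ _ _ (@adjoint R H) 1).
- by congr sum; apply/funext => n; exact: adjoint_comp.
- exact: adjointD.
- by move=> f; rewrite mul1r rnorm_adjoint.
- exact: opmatrix_mul_converges.
Qed.

Lemma multiplier_norms_ub A : J A -> has_ubound (multiplier_norms s A).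
Proof.
move=> JA; exists (C * normJ s A) => _ [B [JB B1] <-].
by have [_] := Jaffard_mul JA JB; rewrite B1 mulr1.
Qed.

Lemma tnormJ_ge0 A : 0 <= tnormJ s A.
Proof. by apply: sup_nonneg => _ [B _ <-]; exact: normJ_ge0. Qed.

(** The definition of [tnormJ] gives this for [D] of norm 1; the general case
    follows by scaling, and a matrix of norm 0 has a product of norm 0. *)
Lemma tnormJ_ub A D : J A -> J D ->
  normJ s (opmatrix_mul A D) <= tnormJ s A * normJ s D.
Proof.
move=> JA JD; have [JAD ADle] := Jaffard_mul JA JD.
have [D0|D0] := eqVneq (normJ s D) 0.
  by rewrite (le_trans ADle)// D0 !mulr0.
have D_gt0 : 0 < normJ s D by rewrite lt_def D0 normJ_ge0.
pose c : R[i] := ((normJ s D)^-1%:C)%C.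
have rc : rnorm c = (normJ s D)^-1.
  by apply: complexI; rewrite rnormE ger0_norm// ler0c invr_ge0 ltW.
have JcD := JaffardZ c JD.
have cD1 : normJ s (c *: D) = 1 by rewrite normJZ// rc mulVf.
rewrite -ler_pdivrMr// mulrC -rc -normJZ// -opmatrix_mulZr//.
by apply: (ub_le_sup (multiplier_norms_ub JA)); exists (c *: D).
Qed.

Lemma tnormJ_le A (M : R) : 0 <= M ->
  (forall D, J D -> normJ s (opmatrix_mul A D) <= M * normJ s D) -> tnormJ s A <= M.
Proof.
move=> M0 AM; apply: sup_le_nonneg => // _ [D [JD D1] <-].
by rewrite (le_trans (AM D JD))// D1 mulr1.
Qed.

(** Test the multiplier norm on the unit matrix. The norm of the latter is
    at most 1; it is 0 when [X] is empty or [H] is trivial. *)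
Lemma normJ_le_tnormJ A : J A -> normJ s A <= tnormJ s A.
Proof.
move=> JA; have [J1 le1] := Jaffard_one.
rewrite -[in leLHS](opmatrix_mulr1 A) (le_trans (tnormJ_ub JA J1))//.
by rewrite ler_piMr ?tnormJ_ge0.
Qed.

Lemma tnormJ_le_normJ A : J A -> tnormJ s A <= C * normJ s A.
Proof.
move=> JA; apply: tnormJ_le => [|D JD]; first by rewrite mulr_ge0 ?normJ_ge0.
exact: (Jaffard_mul JA JD).2.
Qed.

Lemma tnormJZ a A : J A -> tnormJ s (a *: A) = rnorm a * tnormJ s A.
Proof.
move: a A; apply: scale_norm_eq => [a A JA|A]; last exact: tnormJ_ge0.
apply: tnormJ_le => [|D JD]; first by rewrite mulr_ge0 ?rnorm_ge0 ?tnormJ_ge0.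
have [JAD _] := Jaffard_mul JA JD; rewrite opmatrix_mulZl// normJZ// -mulrA.
by rewrite ler_wpM2l ?rnorm_ge0 ?tnormJ_ub.
Qed.

Lemma tnormJD A B : J A -> J B -> tnormJ s (A + B) <= tnormJ s A + tnormJ s B.
Proof.
move=> JA JB; apply: tnormJ_le => [|D JD]; first by rewrite addr_ge0 ?tnormJ_ge0.
have := opmatrix_mulPl 1 JA JB JD; rewrite !scale1r => ->.
rewrite mulrDl (le_trans (normJD (Jaffard_mul JA JD).1 (Jaffard_mul JB JD).1))//.
by rewrite lerD ?tnormJ_ub.
Qed.

(** Multiplier norms are submultiplicative because, by associativity, multiplying
    by a product is composing the multiplications. *)
Lemma tnormJM A B : J A -> J B ->
  tnormJ s (opmatrix_mul A B) <= tnormJ s A * tnormJ s B.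
Proof.
move=> JA JB; apply: tnormJ_le => [|D JD]; first by rewrite mulr_ge0 ?tnormJ_ge0.
have [JBD _] := Jaffard_mul JB JD.
rewrite -opmatrix_mulA// (le_trans (tnormJ_ub JA JBD))// -mulrA.
by rewrite ler_wpM2l ?tnormJ_ge0 ?tnormJ_ub.
Qed.

(** The entries of a Cauchy sequence converge in operator norm, and the weighted
    estimates of their differences pass to the limit uniformly in the entry. *)
Lemma normJ_complete (u : nat -> opmatrix X H) : (forall n : nat, J (u n)) ->
  (forall e : R, 0 < e -> exists n0 : nat, forall m n : nat,
    (n0 <= m)%N -> (n0 <= n)%N ->
    normJ s (u m - u n) < e) ->
  exists2 A, J A & forall e : R, 0 < e -> exists n0 : nat, forall n : nat,
    (n0 <= n)%N ->
    normJ s (u n - A) <= e.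
Proof.
move=> Ju uC.
have entry_lt e : 0 < e -> exists n0 : nat, forall k l (m n : nat),
    (n0 <= m)%N -> (n0 <= n)%N ->
    rnorm (u m k l - u n k l) <= e * w k l.
  move=> /uC[n0 n0P]; exists n0 => k l m n n0m n0n.
  rewrite (le_trans (normJ_ub _ _ (JaffardB (Ju m) (Ju n))))//.
  by apply: (ler_wpM2r (w_ge0 k l)); apply/ltW/n0P.
have entry_cvg k l : cvg ((fun n => u n k l) @ \oo).
  apply: cauchy_cvg; apply/cauchy_rnormP => e e0.
  have w0 : 0 < w k l by rewrite invr_gt0 nu_gt0.
  have [n0 n0P] := entry_lt (e / 2 / w k l) (divr_gt0 (divr_gt0 e0 (ltr0n _ 2)) w0).
  exists (u n0 k l); exists n0 => // n /= n0n.
  rewrite (le_lt_trans (n0P _ _ _ _ (leqnn _) n0n))// divfK ?gt_eqF//; lra.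
pose A : opmatrix X H := fun k l => lim ((fun n => u n k l) @ \oo).
have close e : 0 < e -> exists n0 : nat, forall n : nat, (n0 <= n)%N ->
    J (u n - A) /\ normJ s (u n - A) <= e.
  move=> e0; have [n0 n0P] := entry_lt e e0; exists n0 => n n0n.
  apply: normJ_le => [|k l]; first exact: ltW.
  by apply: (cvg_rnorm_le (entry_cvg k l)); exists n0 => // m; exact: n0P.
exists A => [|e e0].
  have [n0 /(_ n0 (leqnn _))[JuA _]] := close 1 ltr01.
  by rewrite -[A](subKr (u n0)); exact: JaffardB.
by have [n0 n0P] := close e e0; exists n0 => n /n0P[].
Qed.

Lemma tnormJ_complete (u : nat -> opmatrix X H) : (forall n : nat, J (u n)) ->
  (forall e : R, 0 < e -> exists n0 : nat, forall m n : nat,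
    (n0 <= m)%N -> (n0 <= n)%N ->
    tnormJ s (u m - u n) < e) ->
  exists2 A, J A & tnormJ s (u n - A) @[n --> \oo] --> (0 : R).
Proof.
move=> Ju uC; have [e /uC[n0 n0P]|A JA uA] := normJ_complete Ju.
  exists n0 => m n n0m n0n; apply: le_lt_trans (n0P _ _ n0m n0n).
  exact/normJ_le_tnormJ/JaffardB.
exists A => //; apply/cvgrPdist_le => e e0.
have C1 : 0 < C + 1 by rewrite ltr_wpDl.
have [n0 n0P] := uA (e / (C + 1)) (divr_gt0 e0 C1).
exists n0 => // n /= /n0P uAe; rewrite sub0r normrN ger0_norm ?tnormJ_ge0//.
rewrite (le_trans (tnormJ_le_normJ (JaffardB (Ju n) JA)))//.
move: uAe; rewrite ler_pdivlMr// mulrC; apply: le_trans.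
by rewrite ler_wpM2r ?normJ_ge0// lerDl.
Qed.

Lemma opmatrix_star_continuous A : J A -> forall e : R, 0 < e ->
  exists2 r : R, 0 < r & forall B, J B -> tnormJ s (B - A) < r ->
    tnormJ s (opmatrix_star B - opmatrix_star A) < e.
Proof.
move=> JA e e0; have C1 : 0 < C + 1 by rewrite ltr_wpDl.
exists (e / (C + 1)) => [|B JB]; first exact: divr_gt0.
move=> BA; have {}BA : (C + 1) * tnormJ s (B - A) < e.
  by rewrite mulrC -ltr_pdivlMr.
have JBA := JaffardB JB JA.
have -> : opmatrix_star B - opmatrix_star A = opmatrix_star (B - A).
  by rewrite -[in RHS]scaleN1r [in RHS]addrC opmatrix_starP rmorphN1 scaleN1r addrC.
have [JsBA sBA] := Jaffard_star JBA.
rewrite (le_lt_trans (tnormJ_le_normJ JsBA))// (le_lt_trans _ BA)//.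
rewrite ler_pM ?normJ_ge0 ?lerDl// (le_trans sBA)//.
exact: normJ_le_tnormJ.
Qed.

Lemma Jaffard_unital_banach_star_algebra :
  unital_banach_star_algebra J opmatrix_mul (opmatrix_one X H) opmatrix_star (tnormJ s).
Proof.
split.
- exact: Jaffard0.
- by move=> a A B JA JB; exact: (JaffardP a JA JB).1.
- by move=> A B JA JB; exact: (Jaffard_mul JA JB).1.
- exact: Jaffard_one.1.
- by move=> A JA; exact: (Jaffard_star JA).1.
- exact: opmatrix_mulA.
- exact: opmatrix_mulPl.
- exact: opmatrix_mulPr.
- by move=> A _; exact: opmatrix_mul1.
- by move=> A _; exact: opmatrix_mulr1.
- by move=> A _; exact: tnormJ_ge0.
- move=> A JA A0; apply: normJ_eq0 => //; apply/eqP.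
  by rewrite eq_le normJ_ge0 -A0 normJ_le_tnormJ.
- exact: tnormJZ.
- exact: tnormJD.
- exact: tnormJM.
- exact: tnormJ_complete.
- by move=> a A B _ _; exact: opmatrix_starP.
- exact: opmatrix_starM.
- by move=> A _; exact: opmatrix_starK.
- exact: opmatrix_star_continuous.
Qed.

End Algebra.

End JaffardNorm.

Theorem mainTheorem2 (R : realType) (d : nat) (X : set 'rV[R]_d)
    (H : hilbertType R) (s : R) :
  relatively_separated X -> d%:R < s ->
  [/\ (* the series defining the products converge *)
      forall A B : opmatrix X H, Jaffard X H s A -> Jaffard X H s B ->
        opmatrix_mul_cvg A B,
      (* the supremum defining the norm is finite *)
      forall A : opmatrix X H, Jaffard X H s A -> has_ubound (multiplier_norms s A) &
      unital_banach_star_algebra (Jaffard X H s) opmatrix_mul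
        (opmatrix_one X H) opmatrix_star (tnormJ s)].
Proof.
move=> XN ds; have [C C0 CP] := nuV_convolution_bounded XN ds.
have conv (k l : X) F := CP (val k) (val l) F.
split; [exact: (opmatrix_mul_converges conv)|exact: (multiplier_norms_ub C0 conv)|].
exact: (Jaffard_unital_banach_star_algebra H C0 conv).
Qed.
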